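(* Let $(A,m,\Delta)$ be a Hopf algebra over $\mathbb{K}$, with unit $1_A$, counit $\varepsilon$ and antipode $S$. (1) Let $a\in A$. Then $a$ is a left unit of $\ell\mathbf{EAS}'(A,m,\Delta)$ if and only if for any $b\in A$, $S(b)a=\varepsilon(b)a$. (2) Let $\lambda\in A^*$. Then $\lambda$ is a left counit of $\ell\mathbf{EAS}'(A,m,\Delta)$ if and only if for any $b\in A$, $\sum\lambda\bigl(b^{(1)}\bigr)S\bigl(b^{(2)}\bigr)=\lambda(b)1_A$. In particular, right integrals on $(A,m,\Delta)$ are left counits of $\ell\mathbf{EAS}'(A,m,\Delta)$; if $S$ is invertible, then the converse is true (every left counit of $\ell\mathbf{EAS}'(A,m,\Delta)$ is a right integral on $(A,m,\Delta)$).
   Context: $\mathbb{K}$ is a commutative field and $\Delta(b)=\sum b^{(1)}\otimes b^{(2)}$ is Sweedler's notation. For a Hopf algebra $(A,m,\Delta)$ of antipode $S$, $\ell\mathbf{EAS}'(A,m,\Delta)$ denotes the pair $(A,\Phi)$, where $\Phi\colon A\otimes A\to A\otimes A$ is the linear map $\Phi(a\otimes b)=\sum b^{(1)}\otimes S(b^{(2)})a$. For such a pair $(A,\Phi)$: $a\in A$ is a left unit if $\Phi(a\otimes b)=b\otimes a$ for every $b\in A$; $f\in A^*$ is a left counit if $(f\otimes\mathrm{Id})\circ\Phi=\mathrm{Id}\otimes f$, i.e. $(f\otimes\mathrm{Id})\circ\Phi(a\otimes b)=f(b)a$ for all $a,b\in A$. A right integral on $(A,m,\Delta)$ is a linear form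 $\lambda\in A^*$ such that for any $\mu\in A^*$, $(\lambda\otimes\mu)\circ\Delta=\mu(1_A)\lambda$. *)

(* Defs.v *)
From HB Require Import structures.
From mathcomp Require Import all_boot all_algebra.
From mathcomp Require Import boolp.

Set Implicit Arguments.
Unset Strict Implicit.
Unset Printing Implicit Defensive.

Import GRing.Theory.
Local Open Scope ring_scope.
Local Open Scope quotient_scope.

Reserved Notation "u \ox v" (at level 40, left associativity).

(* U (x) V is the commutative monoid of finite formal sums of pairs (u, v)
   (represented by sequences) modulo the congruence generated by the relations
   below.  It is automatically a group, with - (u (x) v) = (- u) (x) v, and a
   vector space, with k (u (x) v) = (k u) (x) v. *)
Inductive tensor_eq (K : fieldType) (U V : lmodType K) :
    seq (U * V) -> seq (U * V) -> Prop :=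
| TensorRefl s : tensor_eq s s
| TensorSym s t : tensor_eq s t -> tensor_eq t s
| TensorTrans s t r : tensor_eq s t -> tensor_eq t r -> tensor_eq s r
| TensorCat s s' t t' :
    tensor_eq s s' -> tensor_eq t t' -> tensor_eq (s ++ t) (s' ++ t')
| TensorCatC s t : tensor_eq (s ++ t) (t ++ s)
| TensorZero v : tensor_eq [:: (0, v)] [::]
| TensorAddl u u' v : tensor_eq [:: (u + u', v)] [:: (u, v); (u', v)]
| TensorAddr u v v' : tensor_eq [:: (u, v + v')] [:: (u, v); (u, v')]
| TensorScale k u v : tensor_eq [:: (k *: u, v)] [:: (u, k *: v)].

Section TensorProduct.
Variables (K : fieldType) (U V : lmodType K).

Definition tensor_rel : rel (seq (U * V)) := fun s t => `[< tensor_eq s t >].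

Lemma tensor_rel_refl : reflexive tensor_rel.
Proof. by move=> s; apply/asboolP; exact: TensorRefl. Qed.

Lemma tensor_rel_sym : symmetric tensor_rel.
Proof. by move=> s t; apply/asboolP/asboolP; exact: TensorSym. Qed.

Lemma tensor_rel_trans : transitive tensor_rel.
Proof.
by move=> t s r /asboolP st /asboolP tr; apply/asboolP; exact: TensorTrans tr.
Qed.

Canonical tensor_equiv :=
  EquivRel tensor_rel tensor_rel_refl tensor_rel_sym tensor_rel_trans.

Definition tensor := {eq_quot tensor_equiv}.
HB.instance Definition _ := Choice.on tensor.
HB.instance Definition _ := EqQuotient.on tensor.

Lemma tensorP (s t : seq (U * V)) :
  reflect (\pi_tensor s = \pi_tensor t) `[< tensor_eq s t >].
Proof. by apply: (iffP idP) => [st|/eqmodP//]; apply/eqmodP. Qed.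

Lemma tensor_piE (s t : seq (U * V)) :
  \pi_tensor s = \pi_tensor t <-> tensor_eq s t.
Proof. by split=> [/tensorP/asboolP//|st]; apply/tensorP/asboolP. Qed.

Lemma tensor_repr (s : seq (U * V)) : tensor_eq (repr (\pi_tensor s)) s.
Proof. by apply/tensor_piE; rewrite reprK. Qed.

Definition tensor_lmul (k : K) (s : seq (U * V)) : seq (U * V) :=
  [seq (k *: p.1, p.2) | p <- s].

Lemma tensor_lmul_eq k s t :
  tensor_eq s t -> tensor_eq (tensor_lmul k s) (tensor_lmul k t).
Proof.
elim=> {s t}.
- by move=> s; exact: TensorRefl.
- by move=> s t _; exact: TensorSym.
- by move=> s t r _ + _; exact: TensorTrans.
- by move=> s s' t t' _ Hs _ Ht; rewrite /tensor_lmul !map_cat; exact: TensorCat.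
- by move=> s t; rewrite /tensor_lmul !map_cat; exact: TensorCatC.
- by move=> v /=; rewrite scaler0; exact: TensorZero.
- by move=> u u' v /=; rewrite scalerDr; exact: TensorAddl.
- by move=> u v v' /=; exact: TensorAddr.
- by move=> l u v /=; rewrite scalerA mulrC -scalerA; exact: TensorScale.
Qed.

Definition tensor_add (x y : tensor) : tensor := \pi_tensor (repr x ++ repr y).
Definition tensor_zero : tensor := \pi_tensor [::].
Definition tensor_scale (k : K) (x : tensor) : tensor :=
  \pi_tensor (tensor_lmul k (repr x)).
Definition tensor_opp (x : tensor) : tensor := tensor_scale (-1) x.

Lemma pi_cat s t : tensor_add (\pi s) (\pi t) = \pi_tensor (s ++ t).
Proof. by apply/tensor_piE; apply: TensorCat; exact: tensor_repr. Qed.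

Lemma pi_lmul k s : tensor_scale k (\pi s) = \pi_tensor (tensor_lmul k s).
Proof. by apply/tensor_piE; apply: tensor_lmul_eq; exact: tensor_repr. Qed.

Lemma tensor_addA : associative tensor_add.
Proof. by elim/quotW=> s; elim/quotW=> t; elim/quotW=> r; rewrite !pi_cat catA. Qed.

Lemma tensor_addC : commutative tensor_add.
Proof.
elim/quotW=> s; elim/quotW=> t; rewrite !pi_cat.
by apply/tensor_piE; exact: TensorCatC.
Qed.

Lemma tensor_add0 : left_id tensor_zero tensor_add.
Proof. by elim/quotW=> s; rewrite pi_cat. Qed.

Lemma tensor_addlmul (k l : K) s :
  tensor_eq (tensor_lmul k s ++ tensor_lmul l s) (tensor_lmul (k + l) s).
Proof.
elim: s => [|[u v] s IHs] /=; first exact: TensorRefl.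
apply: (@TensorTrans _ _ _ _ ([:: (k *: u, v); (l *: u, v)] ++
    (tensor_lmul k s ++ tensor_lmul l s))); last first.
  rewrite -[_ :: tensor_lmul _ _]cat1s; apply: TensorCat => //.
  by rewrite scalerDl; apply: TensorSym; exact: TensorAddl.
rewrite -cat1s -[(l *: u, v) :: tensor_lmul _ _]cat1s.
rewrite -[[:: _; _]]/([:: (k *: u, v)] ++ [:: (l *: u, v)]) -[X in tensor_eq _ X]catA.
apply: TensorCat; first exact: TensorRefl.
by rewrite !catA; apply: TensorCat; [exact: TensorCatC | exact: TensorRefl].
Qed.

Lemma tensor_lmul0 s : tensor_eq (tensor_lmul 0 s) [::].
Proof.
elim: s => [|[u v] s IHs] /=; first exact: TensorRefl.
by rewrite scale0r -cat1s -[[::]]cats0; apply: TensorCat => //; exact: TensorZero.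
Qed.

Lemma tensor_lmul1 s : tensor_lmul 1 s = s.
Proof. by rewrite /tensor_lmul -[RHS]map_id; apply: eq_map => -[u v]; rewrite scale1r. Qed.

Lemma tensor_addN : left_inverse tensor_zero tensor_opp tensor_add.
Proof.
elim/quotW=> s; rewrite /tensor_opp pi_lmul pi_cat; apply/tensor_piE.
rewrite -[X in _ ++ X]tensor_lmul1; apply: TensorTrans (tensor_addlmul _ _ _) _.
by rewrite addNr; exact: tensor_lmul0.
Qed.

HB.instance Definition _ := GRing.isZmodule.Build tensor
  tensor_addA tensor_addC tensor_add0 tensor_addN.

Lemma tensor_scaleA k l x :
  tensor_scale k (tensor_scale l x) = tensor_scale (k * l) x.
Proof.
elim/quotW: x => s; rewrite !pi_lmul /tensor_lmul -map_comp.
by congr (\pi_tensor _); apply: eq_map => p /=; rewrite scalerA.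
Qed.

Lemma tensor_scale1 : left_id 1 tensor_scale.
Proof. by elim/quotW=> s; rewrite pi_lmul tensor_lmul1. Qed.

Lemma tensor_scaleDr : right_distributive tensor_scale +%R.
Proof.
move=> k; elim/quotW=> s; elim/quotW=> t.
rewrite -[_ + _]/(tensor_add _ _) -[RHS]/(tensor_add _ _).
by rewrite pi_cat !pi_lmul pi_cat /tensor_lmul map_cat.
Qed.

Lemma tensor_scaleDl x : {morph tensor_scale^~ x : k l / k + l}.
Proof.
move=> k l; elim/quotW: x => s; rewrite -[RHS]/(tensor_add _ _) !pi_lmul pi_cat.
by apply/tensor_piE; apply: TensorSym; exact: tensor_addlmul.
Qed.

HB.instance Definition _ := GRing.Zmodule_isLmodule.Build K tensor
  tensor_scaleA tensor_scale1 tensor_scaleDr tensor_scaleDl.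

Definition tens (u : U) (v : V) : tensor := \pi_tensor [:: (u, v)].

End TensorProduct.

Arguments tensor {K} U V.

Notation "u \ox v" := (tens u v) : ring_scope.

Notation is_bilinear f := (bilinear_for *:%R *:%R f).

(* The linear map U (x) V -> W induced by f; only meaningful when f is
   bilinear, since otherwise its value depends on the chosen representative.
   With x (x) y standing for b^(1) (x) b^(2), the Sweedler expression
   \sum f(b^(1), b^(2)) is tlift f (Delta b). *)
Definition tlift (K : fieldType) (U V W : lmodType K) (f : U -> V -> W)
    (t : tensor U V) : W :=
  \sum_(p <- repr t) f p.1 p.2.

Section TensorTheory.
Variables (K : fieldType) (U V : lmodType K).

Lemma tens_bilinear : is_bilinear (@tens K U V).
Proof.
split=> [v k u u'|u k v v']; 
    rewrite -[RHS]/(tensor_add (tensor_scale _ _) _) pi_lmul pi_cat;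
    apply/tensor_piE => /=.
  exact: TensorAddl.
apply: TensorTrans (TensorAddr _ _ _) _; rewrite -cat1s -[X in tensor_eq _ X]cat1s.
apply: TensorCat; last exact: TensorRefl.
by apply: TensorSym; exact: TensorScale.
Qed.

Lemma tensor_sum (t : tensor U V) : t = \sum_(p <- repr t) p.1 \ox p.2.
Proof.
rewrite -{1}[t]reprK; elim: (repr t) => [|[u v] s IHs]; first by rewrite big_nil.
by rewrite big_cons -IHs -[RHS]/(tensor_add _ _) pi_cat.
Qed.

Variables (W : lmodType K) (f : U -> V -> W).
Hypothesis f_bilin : is_bilinear f.

Let fZl k u v : f (k *: u) v = k *: f u v.
Proof.
have f0 : f 0 v = 0.
  by have := f_bilin.1 v (-1) 0 0; rewrite /= scaler0 addr0 scaleN1r addNr.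
by have := f_bilin.1 v k u 0; rewrite !addr0 f0 addr0.
Qed.

Let fZr k u v : f u (k *: v) = k *: f u v.
Proof.
have f0 : f u 0 = 0.
  by have := f_bilin.2 u (-1) 0 0; rewrite /= scaler0 addr0 scaleN1r addNr.
by have := f_bilin.2 u k v 0; rewrite !addr0 f0 addr0.
Qed.

Lemma tensor_eq_sum s t : tensor_eq s t ->
  \sum_(p <- s) f p.1 p.2 = \sum_(p <- t) f p.1 p.2.
Proof.
elim=> {s t} //.
- by move=> s t r _ -> _ ->.
- by move=> s s' t t' _ Hs _ Ht; rewrite !big_cat /= Hs Ht.
- by move=> s t; rewrite !big_cat /= addrC.
- by move=> v; rewrite big_seq1 big_nil /=; have := fZl 0 0 v; rewrite !scale0r.
- move=> u u' v; rewrite !big_cons !big_nil /= !addr0.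
  by have := f_bilin.1 v 1 u u' => /=; rewrite !scale1r.
- move=> u v v'; rewrite !big_cons !big_nil /= !addr0.
  by have := f_bilin.2 u 1 v v' => /=; rewrite !scale1r.
- by move=> k u v; rewrite !big_seq1 /= fZl fZr.
Qed.

Lemma tlift_pi s : tlift f (\pi s) = \sum_(p <- s) f p.1 p.2.
Proof. by apply: tensor_eq_sum; exact: tensor_repr. Qed.

Lemma tlift_tens u v : tlift f (u \ox v) = f u v.
Proof. by rewrite tlift_pi big_seq1. Qed.

Lemma tlift_linear : linear (tlift f).
Proof.
move=> k; elim/quotW=> s; elim/quotW=> t.
rewrite -[k *: _ + _]/(tensor_add (tensor_scale _ _) _) pi_lmul pi_cat !tlift_pi.
rewrite big_cat /= big_map scaler_sumr; congr (_ + _).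
by apply: eq_bigr => p _; rewrite /= fZl.
Qed.

End TensorTheory.

Lemma tlift_unique (K : fieldType) (U V W : lmodType K)
    (g h : {linear tensor U V -> W}) :
  (forall u v, g (u \ox v) = h (u \ox v)) -> g =1 h.
Proof.
move=> gh t; rewrite (tensor_sum t) !linear_sum /=.
by apply: eq_bigr => p _.
Qed.

Lemma tensPl (K : fieldType) (U V : lmodType K) (v : V) k (u u' : U) :
  (k *: u + u') \ox v = k *: (u \ox v) + u' \ox v.
Proof. exact: (tens_bilinear U V).1. Qed.

Lemma tensPr (K : fieldType) (U V : lmodType K) (u : U) k (v v' : V) :
  u \ox (k *: v + v') = k *: (u \ox v) + u \ox v'.
Proof. exact: (tens_bilinear U V).2. Qed.

Section TensorMaps.
Variable K : fieldType.

Definition tmap (U V U' V' : lmodType K) (f : U -> U') (g : V -> V') :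
    tensor U V -> tensor U' V' :=
  tlift (fun u v => f u \ox g v).

Lemma tmap_bilinear (U V U' V' : lmodType K)
    (f : {linear U -> U'}) (g : {linear V -> V'}) :
  is_bilinear (fun u v => f u \ox g v).
Proof.
by split=> [v|u] k x y /=; rewrite linearP; [rewrite tensPl | rewrite tensPr].
Qed.

Lemma tmap_tens (U V U' V' : lmodType K)
    (f : {linear U -> U'}) (g : {linear V -> V'}) u v :
  tmap f g (u \ox v) = f u \ox g v.
Proof. by rewrite /tmap tlift_tens //; exact: tmap_bilinear. Qed.

Lemma tmap_linear (U V U' V' : lmodType K)
    (f : {linear U -> U'}) (g : {linear V -> V'}) : linear (tmap f g).
Proof. by apply: tlift_linear; exact: tmap_bilinear. Qed.

Definition tassoc (U V W : lmodType K) :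
    tensor (tensor U V) W -> tensor U (tensor V W) :=
  tlift (fun t w => tlift (fun u v => u \ox (v \ox w)) t).

Definition tmul (A B : algType K) (s t : tensor A B) : tensor A B :=
  tlift (fun a b => tlift (fun c d => (a * c) \ox (b * d)) t) s.

(* f (x) Id, Id (x) f and f (x) g, for linear forms f and g, after the
   identifications K (x) V = V, V (x) K = V and K (x) K = K. *)
Definition tforml (V W : lmodType K) (f : V -> K) : tensor V W -> W :=
  tlift (fun v w => f v *: w).

Definition tformr (V W : lmodType K) (f : W -> K) : tensor V W -> V :=
  tlift (fun v w => f w *: v).

Definition tform2 (V W : lmodType K) (f : V -> K) (g : W -> K) :
    tensor V W -> K^o :=
  tlift (fun v w => f v * g w : K^o).

Lemma tlift_linear2 (T U V W : lmodType K) (f : T -> U -> V -> W) (x : tensor U V) :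
  (forall u v, linear (fun t => f t u v)) -> linear (fun t => tlift (f t) x).
Proof.
move=> f_lin k t t'; rewrite /tlift scaler_sumr -big_split /=.
by apply: eq_bigr => p _; rewrite f_lin.
Qed.

Lemma tassoc_tens (U V W : lmodType K) (u : U) (v : V) (w : W) :
  tassoc ((u \ox v) \ox w) = u \ox (v \ox w).
Proof.
have bil w' : is_bilinear (fun (u : U) (v : V) => u \ox (v \ox w')).
  by split=> [y|x] k a b /=; rewrite ?tensPl ?tensPr.
rewrite /tassoc tlift_tens ?tlift_tens //; split=> [y|x] k a b /=.
  by rewrite tlift_linear.
by apply: (tlift_linear2 (f := fun w u v => u \ox (v \ox w))) => ? ? ? ? ?;
  rewrite !tensPr.
Qed.

Lemma tmul_tens (A B : algType K) (a c : A) (b d : B) :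
  tmul (a \ox b) (c \ox d) = (a * c) \ox (b * d).
Proof.
have bil a' b' : is_bilinear (fun (c : A) (d : B) => (a' * c) \ox (b' * d)).
  by split=> [y|x] k u v /=; rewrite mulrDr -scalerAr ?tensPl ?tensPr.
rewrite /tmul tlift_tens ?tlift_tens //; split=> [y|x] k u v /=.
  by apply: (tlift_linear2 (f := fun u c d => (u * c) \ox (y * d))) => ? ? ? ? ?;
    rewrite mulrDl -scalerAl tensPl.
by apply: (tlift_linear2 (f := fun v c d => (x * c) \ox (v * d))) => ? ? ? ? ?;
  rewrite mulrDl -scalerAl tensPr.
Qed.

Lemma tforml_tens (V W : lmodType K) (f : {scalar V}) v w :
  tforml f (v \ox w) = f v *: w :> W.
Proof.
rewrite /tforml tlift_tens //; split=> [y|x] k a b /=.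
  by rewrite linearP scalerDl scalerA.
by rewrite scalerDr !scalerA mulrC.
Qed.

Lemma tformr_tens (V W : lmodType K) (f : {scalar W}) v w :
  tformr f (v \ox w) = f w *: v :> V.
Proof.
rewrite /tformr tlift_tens //; split=> [y|x] k a b /=.
  by rewrite scalerDr !scalerA mulrC.
by rewrite linearP scalerDl scalerA.
Qed.

Lemma tform2_tens (V W : lmodType K) (f : {scalar V}) (g : {scalar W}) v w :
  tform2 f g (v \ox w) = f v * g w.
Proof.
rewrite /tform2 tlift_tens //; split=> [y|x] k a b /=.
  by rewrite linearP mulrDl -mulrA.
by rewrite linearP mulrDr mulrCA.
Qed.

End TensorMaps.

HB.mixin Record Lmodule_isCoalgebra (K : fieldType) C of GRing.Lmodule K C := {
  comul : {linear C -> tensor C C};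
  counit : {scalar C};
  comulA : forall c,
    tassoc (tmap comul idfun (comul c)) = tmap idfun comul (comul c);
  counitl : forall c, tforml counit (comul c) = c;
  counitr : forall c, tformr counit (comul c) = c
}.

#[short(type="coalgType")]
HB.structure Definition Coalgebra (K : fieldType) :=
  {C of Lmodule_isCoalgebra K C & GRing.Lmodule K C}.

HB.mixin Record Coalgebra_isBialgebra (K : fieldType) B
    of GRing.Algebra K B & Coalgebra K B := {
  comulM : forall x y : B, comul (x * y) = tmul (comul x) (comul y);
  comul1 : comul (1 : B) = 1 \ox 1;
  counitM : forall x y : B, counit (x * y) = counit x * counit y;
  counit1 : counit (1 : B) = 1
}.

#[short(type="bialgType")]
HB.structure Definition Bialgebra (K : fieldType) :=
  {B of Coalgebra_isBialgebra K B & GRing.Algebra K B & Coalgebra K B}.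

HB.mixin Record Bialgebra_isHopf (K : fieldType) A of Bialgebra K A := {
  antipode : {linear A -> A};
  antipodel : forall a : A,
    tlift (fun x y => antipode x * y) (comul a) = counit a *: 1;
  antipoder : forall a : A,
    tlift (fun x y => x * antipode y) (comul a) = counit a *: 1
}.

#[short(type="hopfAlgType")]
HB.structure Definition HopfAlgebra (K : fieldType) :=
  {A of Bialgebra_isHopf K A & Bialgebra K A}.

Section LeftUnits.
Variables (K : fieldType) (A : lmodType K)
  (Phi : {linear tensor A A -> tensor A A}).

Definition left_unit (a : A) : Prop := forall b : A, Phi (a \ox b) = b \ox a.

Definition left_counit (f : {scalar A}) : Prop :=
  tforml f \o Phi =1 tformr f.

End LeftUnits.

Definition right_integral (K : fieldType) (A : bialgType K) (lam : {scalar A}) :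
    Prop :=
  forall (mu : {scalar A}) (b : A),
    tform2 lam mu (comul b) = mu 1 * lam b.

Section LEAS.
Variables (K : fieldType) (A : hopfAlgType K).

(* a (x) b |-> \sum b^(1) (x) S(b^(2)) a *)
Definition lEAS' : tensor A A -> tensor A A :=
  tlift (fun a b => tlift (fun x y => x \ox (antipode y * a)) (comul b)).

Lemma lEAS'_inner_bilinear (a : A) :
  is_bilinear (fun x y : A => x \ox (antipode y * a)).
Proof.
split=> [y|x] k u v /=; first by rewrite tensPl.
by rewrite linearP mulrDl -scalerAl tensPr.
Qed.

Lemma lEAS'_bilinear : is_bilinear
  (fun a b : A => tlift (fun x y : A => x \ox (antipode y * a)) (comul b)).
Proof.
split=> [b|a] k u v /=; last first.
  by rewrite linearP tlift_linear //; exact: lEAS'_inner_bilinear.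
rewrite /tlift scaler_sumr -big_split /=; apply: eq_bigr => p _.
by rewrite mulrDr -scalerAr tensPr.
Qed.

Lemma lEAS'_linear : linear lEAS'.
Proof. by apply: tlift_linear; exact: lEAS'_bilinear. Qed.

HB.instance Definition _ :=
  GRing.isLinear.Build K (tensor A A) (tensor A A) _ lEAS' lEAS'_linear.

Lemma lEAS'_tens (a b : A) :
  lEAS' (a \ox b) = tlift (fun x y => x \ox (antipode y * a)) (comul b).
Proof. by rewrite /lEAS' tlift_tens //; exact: lEAS'_bilinear. Qed.

End LEAS.

Arguments lEAS' {K} A.

(* Main.v *)
Require Import Defs.
From HB Require Import structures.
From mathcomp Require Import all_boot all_algebra.
From mathcomp Require boolp classical_sets.

Set Implicit Arguments.
Unset Strict Implicit.
Unset Printing Implicit Defensive.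

Import GRing.Theory.
Local Open Scope ring_scope.

(** Everything is expressed through one element of [A], the contraction
    [T b = \sum lam(b^(1)) b^(2)], that is [tforml lam (comul b)].  Applying
    [lam (x) Id] to [Phi (a (x) b) = \sum b^(1) (x) S(b^(2)) a] gives
    [S (T b) a] (lemma [tforml_lEAS']).

    For [lam = counit] the contraction is [b] itself, so applying
    [counit (x) Id] to the left unit equation yields [S b a = counit b a];
    conversely that identity, applied to [b^(2)] under the sum, reduces
    [\sum b^(1) (x) S(b^(2)) a] to [\sum b^(1) counit(b^(2)) (x) a = b (x) a].

    For a general [lam], being a left counit means [S (T b) a = lam b a] for
    all [a] and [b], equivalently [S (T b) = lam b 1] (take [a = 1]).  Being a
    right integral means [mu (T b) = lam b mu(1)] for all linear forms [mu],
    equivalently [T b = lam b 1], because linear forms separate the points of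
    a vector space (lemma [linear_form_separates]).  As [S 1 = 1], applying [S]
    takes the second condition to the first, and the step is reversible when
    [S] is injective.

    In infinite dimension the separation of points needs a form of the axiom
    of choice; it is obtained from Zorn's lemma. *)

(** * Linear forms on a vector space separate points *)

Section Separation.
Import boolp classical_sets.
Local Open Scope classical_set_scope.

Definition submodule_avoiding (K : fieldType) (V : lmodType K) (x : V)
    (M : set V) : Prop :=
  (forall k u v, M u -> M v -> M (k *: u + v)) /\ ~ M x.

(** A maximal submodule avoiding [x] is a hyperplane supplementary to the line
    of [x]: if [w] lies outside [M], then [M + K w] contains [x] by
    maximality, hence [w] is a multiple of [x] modulo [M].  The union of the
    empty chain is empty, which is why [submodule_avoiding] does not ask for
    [0]; that the maximal [M] contains [0] follows by comparing it with the
    zero submodule. *)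
Lemma exists_hyperplane (K : fieldType) (V : lmodType K) (x : V) : x != 0 ->
  exists M : set V, [/\ submodule_avoiding x M, M 0 &
    forall w, exists k, M (w - k *: x)].
Proof.
move=> x0; have [F FP tot|M [MP Mmax]] := @Zorn_bigcup V (submodule_avoiding x).
  split=> [k u v [X FX Xu] [Y FY Yv]|[X FX Xx]]; last exact: (FP _ FX).2.
  case: (tot _ _ FX FY) => [XY|YX].
    by exists Y => //; apply: (FP _ FY).1 => //; apply: XY.
  by exists X => //; apply: (FP _ FX).1 => //; apply: YX.
have [Mlin Mx] := MP.
have M0 : M 0.
  have [[m Mm]|M_empty] := pselect (M !=set0).
    by rewrite -(addNr m) -scaleN1r; exact: Mlin.
  exfalso; apply: (Mmax [set 0]).
    split=> [u Mu|sub0M]; first by case: M_empty; exists u.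
    by apply: M_empty; exists 0; exact: sub0M.
  split=> [k u v /= -> ->|/= /eqP]; first by rewrite scaler0 addr0.
  by rewrite (negbTE x0).
exists M; split=> // w.
have [Mw|nMw] := pselect (M w); first by exists 0; rewrite scale0r subr0.
pose N : set V := [set u | exists k m, M m /\ u = k *: w + m].
have [[k [m [Mm xE]]]|Nx] := pselect (N x).
  have k0 : k != 0.
    by apply/eqP=> kE; apply: Mx; rewrite xE kE scale0r add0r.
  exists k^-1; rewrite xE scalerDr scalerA mulVf // scale1r opprD addrA subrr add0r.
  by rewrite -scaleNr -[_ *: _]addr0; exact: Mlin.
exfalso; apply: (Mmax N).
  split=> [u Mu|NM]; first by exists 0, u; rewrite scale0r add0r.
  by apply: nMw; apply: NM; exists 1, 0; rewrite scale1r addr0.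
split=> // k _ _ [p [m [Mm ->]]] [q [n [Mn ->]]].
exists (k * p + q), (k *: m + n); split; first exact: Mlin.
by rewrite scalerDr scalerA scalerDl addrACA.
Qed.

(** The value of the form at [w] is the unique [k] such that [w - k x] lies in
    a hyperplane supplementary to the line of [x]. *)
Lemma exists_linear_form (K : fieldType) (V : lmodType K) (x : V) : x != 0 ->
  exists mu : {scalar V}, mu x = 1.
Proof.
move=> /exists_hyperplane[M [[Mlin Mx] M0 /choice[f Mf]]].
have MZ k u : M u -> M (k *: u) by move=> Mu; rewrite -[_ *: _]addr0; exact: Mlin.
have f_uniq w k : M (w - k *: x) -> f w = k.
  move=> Mk; apply/eqP; rewrite -subr_eq0; apply: contrapT => /negP dk0.
  apply: Mx; rewrite -[x](scalerK dk0); apply: MZ.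
  have -> : (f w - k) *: x = -1 *: (w - f w *: x) + (w - k *: x).
    by rewrite scaleN1r opprB addrA subrK scalerBl.
  exact: Mlin.
have f_lin : linear_for *%R f.
  move=> k u v; apply: f_uniq; rewrite scalerDl -scalerA opprD addrACA -scalerBr.
  exact: Mlin.
pose mu : {scalar V} :=
  HB.pack f (GRing.isLinear.Build K V K *%R f f_lin).
by exists mu; apply: f_uniq; rewrite scale1r subrr.
Qed.

End Separation.

Lemma linear_form_separates (K : fieldType) (V : lmodType K) (u v : V) :
  (forall mu : {scalar V}, mu u = mu v) -> u = v.
Proof.
move=> muE; apply/eqP; rewrite -subr_eq0; apply: contraT.
move=> /exists_linear_form[mu]; rewrite linearB muE subrr => /esym/eqP.
by rewrite oner_eq0.
Qed.

(** * Contracting tensors *)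

Lemma linear_tlift (K : fieldType) (U V W X : lmodType K) (h : {linear W -> X})
    (f : U -> V -> W) (t : tensor U V) :
  h (tlift f t) = tlift (fun u v => h (f u v)) t.
Proof. by rewrite /tlift linear_sum. Qed.

Lemma eq_tlift (K : fieldType) (U V W : lmodType K) (f g : U -> V -> W)
    (t : tensor U V) :
  (forall u v, f u v = g u v) -> tlift f t = tlift g t.
Proof. by move=> fg; apply: eq_bigr => p _. Qed.

Section Contraction.
Variables (K : fieldType) (U V W : lmodType K).

Lemma tens_balanced (k : K) (u : U) (v : V) : u \ox (k *: v) = (k *: u) \ox v.
Proof. by apply/tensor_piE/TensorSym/TensorScale. Qed.

Lemma tforml_linear (f : {scalar U}) : linear (tforml f : tensor U V -> V).
Proof.
apply: tlift_linear; split=> [v|u] k x y /=.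
  by rewrite linearP scalerDl scalerA.
by rewrite scalerDr !scalerA mulrC.
Qed.

HB.instance Definition _ (f : {scalar U}) :=
  GRing.isLinear.Build K (tensor U V) V _ (tforml f) (tforml_linear f).

Lemma tformr_linear (f : {scalar V}) : linear (tformr f : tensor U V -> U).
Proof.
apply: tlift_linear; split=> [v|u] k x y /=.
  by rewrite scalerDr !scalerA mulrC.
by rewrite linearP scalerDl scalerA.
Qed.

HB.instance Definition _ (f : {scalar V}) :=
  GRing.isLinear.Build K (tensor U V) U _ (tformr f) (tformr_linear f).

Lemma linear_tforml (f : {scalar U}) (h : {linear V -> W}) t :
  h (tforml f t) = tlift (fun u v => f u *: h v) t.
Proof. by rewrite /tforml linear_tlift; apply: eq_tlift => u v; exact: linearZ. Qed.

Lemma tform2E (f : {scalar U}) (g : {scalar V}) t :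
  tform2 f g t = g (tforml f t).
Proof.
rewrite /tform2 /tforml /tlift linear_sum.
by apply: eq_bigr => p _; rewrite linearZ.
Qed.

End Contraction.

(** * Left units and left counits *)

Section LeftUnitsCounits.
Variables (K : fieldType) (A : hopfAlgType K).
Implicit Types (a b : A) (lam : {scalar A}).

Lemma antipode1 : antipode (1 : A) = 1.
Proof.
have := antipodel (1 : A); rewrite comul1 counit1 scale1r tlift_tens ?mulr1 //.
by split=> [v|u] k x y /=; [rewrite linearP mulrDl -scalerAl
                          | rewrite mulrDr -scalerAr].
Qed.

Lemma tforml_lEAS' lam a b :
  tforml lam (lEAS' A (a \ox b)) = antipode (tforml lam (comul b)) * a.
Proof.
rewrite lEAS'_tens linear_tlift linear_tforml /tlift mulr_suml.
by apply: eq_bigr => p _; rewrite /= tforml_tens scalerAl.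
Qed.

Lemma left_unitP a :
  left_unit (lEAS' A) a <-> forall b, antipode b * a = counit b *: a.
Proof.
split=> [unit_a b|Sa b].
  have /(congr1 (tforml counit)) := unit_a b.
  by rewrite tforml_lEAS' counitl tforml_tens.
rewrite /= lEAS'_tens -{2}[b]counitr.
have tens_lin : linear (fun x : A => x \ox a) by move=> k u v; exact: tensPl.
(* [b (x) a] is the image of [\sum counit(b^(2)) b^(1)] under [- (x) a], and
   scalars move across the tensor sign. *)
pose tens_a : {linear A -> tensor A A} :=
  HB.pack (fun x : A => x \ox a) (GRing.isLinear.Build K A _ _ _ tens_lin).
rewrite -[RHS]/(tens_a _) /tformr linear_tlift; apply: eq_tlift => x y.
by rewrite Sa tens_balanced.
Qed.

(** The left counit equation is linear in its tensor argument, so it may be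
    tested on pure tensors [a (x) b]; there [a] only enters as a right factor
    and can be taken to be [1]. *)
Lemma left_counitP lam :
  left_counit (lEAS' A) lam <->
  forall b, antipode (tforml lam (comul b)) = lam b *: 1.
Proof.
split=> [counit_lam b|Slam].
  by have /= := counit_lam (1 \ox b); rewrite tforml_lEAS' tformr_tens mulr1.
apply: (@tlift_unique K A A A (tforml lam \o lEAS' A) (tformr lam)) => a b /=.
by rewrite tforml_lEAS' tformr_tens Slam -scalerAl mul1r.
Qed.

Lemma right_integralP lam :
  right_integral lam <-> forall b, tforml lam (comul b) = lam b *: 1.
Proof.
split=> [int_lam b|Tlam mu b]; last by rewrite tform2E Tlam linearZ mulrC.
by apply: linear_form_separates => mu; rewrite -tform2E int_lam linearZ mulrC.
Qed.

End LeftUnitsCounits.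

Theorem proposition5p15 (K : fieldType) (A : hopfAlgType K) :
  (forall a : A,
     left_unit (lEAS' A) a <->
     (forall b : A, antipode b * a = counit b *: a)) /\
  (forall lam : {scalar A},
     left_counit (lEAS' A) lam <->
     (forall b : A,
        tlift (fun x y : A => lam x *: (antipode y : A)) (comul b)
        = lam b *: (1 : A))) /\
  (forall lam : {scalar A},
     right_integral lam -> left_counit (lEAS' A) lam) /\
  (bijective (antipode : A -> A) ->
   forall lam : {scalar A},
     left_counit (lEAS' A) lam -> right_integral lam).
Proof.
split; first exact: left_unitP.
split=> [lam|].
  by split=> [/left_counitP|] Slam; [|apply/left_counitP];
    move=> b; have := Slam b; rewrite linear_tforml.
split=> [lam /right_integralP Tlam|S_bij lam /left_counitP Slam].
  by apply/left_counitP => b; rewrite Tlam linearZ /= antipode1.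
apply/right_integralP => b; apply: (bij_inj S_bij).
by rewrite Slam linearZ /= antipode1.
Qed.
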